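(* Let $S$ be a monoid and let $G$ be a subgroup of $S$. If $S$ has finite derivation type, and $G$ has finite translational index in $S$, then $G$ has finite derivation type.
   Context: A subgroup of $S$ is a subsemigroup that is a group (its identity $e$ is an idempotent of $S$, not necessarily the identity of $S$). A (right) coset of $G$ in $S$ is a set $Gs$ with $s\in S$ for which there exists $s'\in S$ with $Gss'=G$. The (right) translational index of $G$ in $S$ is the number of right cosets of $G$ in this sense; $G$ has finite translational index if this number is finite. Presentations. For an alphabet $A$ let $A^*$, $A^+$ be the free monoid and free semigroup on $A$; $u\equiv v$ means equality as words. A semigroup presentation is $\langle A\mid R\rangle$ with $R\subseteq A^+\times A^+$; a rule is $r=(r_{+1},r_{-1})\in R$. It defines the semigroup $A^+/\!\leftrightarrow_R^*$, where $\leftrightarrow_R^*$ is the congruence generated by $R$. It is finite if $A$ and $R$ are finite. Derivation graph. The derivation graph $\Gamma=\Gamma(\mathcal P)$ of $\mathcal P=\langle A\mid R\rangle$ has vertex set $A^+$ and edges $\mathbb E=(w_1,r,\epsilon,w_2)$ with $w_1,w_2\in A^*$, $r\in R$, $\epsilon\in\{+1,-1\}$; $\iota\mathbb E\equiv w_1r_{\epsilon}w_2$, $\tau\mathbb E\equiv w_1r_{-\epsilon}w_2$, $\mathbb E^{-1}=(w_1,r,-\epsilon,w_2)$. Paths are sequences of composable edges, including an empty path $1_w$ at each vertex $w$; $P(\Gamma)$ is the set of all paths; $\iota,\tau,{}^{-1}$ extend to paths. For $x,y\in A^*$, $x\cdot(w_1,r,\epsilon,w_2)\cdot y=(xw_1,r,\epsilon,w_2y)$,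 extended edgewise to paths. Paths with the same initial and the same terminal vertices are parallel, written $\parallel$. A homotopy relation is an equivalence relation $\sim$ on $P(\Gamma)$ contained in $\parallel$ such that: (H1) $(\mathbb E_1\cdot\iota\mathbb E_2)(\tau\mathbb E_1\cdot\mathbb E_2)\sim(\iota\mathbb E_1\cdot\mathbb E_2)(\mathbb E_1\cdot\tau\mathbb E_2)$ for all edges $\mathbb E_1,\mathbb E_2$; (H2) $\mathbb P\sim\mathbb Q$ implies $x\cdot\mathbb P\cdot y\sim x\cdot\mathbb Q\cdot y$ for all $x,y\in A^*$; (H3) $\mathbb P\sim\mathbb Q$ implies $\mathbb R\mathbb P\mathbb S\sim\mathbb R\mathbb Q\mathbb S$ whenever the compositions are defined; (H4) $\mathbb P\mathbb P^{-1}\sim 1_{\iota\mathbb P}$ for every path. For $C\subseteq\,\parallel$, $\sim_C$ is the smallest homotopy relation containing $C$; $C$ is a homotopy base if $\sim_C\,=\,\parallel$. A presentation has finite derivation type (FDT) if its derivation graph has a finite homotopy base. A finitely presented semigroup (or monoid) has FDT if some finite semigroup presentation defining it has FDT; it is known that then every finite presentation of it does, and that for monoids using monoid or semigroup presentations gives the same notion. Having FDT includes being finitely presented. *)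

(* Defs.v *)
From HB Require Import structures.
From mathcomp Require Import all_boot generic_quotient.
From mathcomp Require Import boolp classical_sets cardinality.

Set Implicit Arguments.
Unset Strict Implicit.
Unset Printing Implicit Defensive.

Local Open Scope classical_set_scope.
Local Open Scope group_scope.
Local Open Scope quotient_scope.

(** The identity of a subgroup is an idempotent of [S] which, when [S] is a
    monoid, need not be the identity of [S]. *)
Record subgroup (S : semigroupType) := Subgroup {
  subgroup_set :> set S;
  subgroupM : forall x y, subgroup_set x -> subgroup_set y ->
    subgroup_set (x * y);
  subgroup_group : exists2 e, subgroup_set e &
    forall x, subgroup_set x ->
      [/\ e * x = x, x * e = x &
          exists2 y, subgroup_set y & x * y = e /\ y * x = e] }.

Lemma subgroup_mulg_closed (S : semigroupType) (G : subgroup S) :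
  mulg_closed (mem (G : set S)).
Proof. by move=> x y; rewrite !inE; apply: subgroupM. Qed.

Definition subgroup_type (S : semigroupType) (G : subgroup S) := set_type G.

HB.instance Definition _ (S : semigroupType) (G : subgroup S) :=
  SubChoice.copy (subgroup_type G) (set_type G).
HB.instance Definition _ (S : semigroupType) (G : subgroup S) :=
  SubChoice_isSubSemigroup.Build S (mem (G : set S)) (subgroup_type G)
    (@subgroup_mulg_closed S G).

Definition rtranslate (S : semigroupType) (C : set S) (s : S) : set S :=
  [set g * s | g in C].

Definition right_cosets (S : semigroupType) (G : subgroup S) : set (set S) :=
  [set C | exists s, C = rtranslate G s /\
                     exists s', rtranslate (rtranslate G s) s' = G].

Definition finite_translational_index (S : semigroupType) (G : subgroup S) :=
  finite_set (right_cosets G).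

(** The free semigroup A^+. *)
Record fsg (A : choiceType) := FSG { fsgval :> seq A; _ : fsgval != [::] }.

HB.instance Definition _ (A : choiceType) := [isSub for @fsgval A].
HB.instance Definition _ (A : choiceType) := [Choice of fsg A by <:].

Lemma fsg_ctx_subproof (A : choiceType) (x : seq A) (u : fsg A) (y : seq A) :
  x ++ u ++ y != [::].
Proof. by case: u => -[|a u] //= u0; case: x. Qed.

(** The word [x u y] for [x, y] in A^* and [u] in A^+. *)
Definition fsg_ctx (A : choiceType) (x : seq A) (u : fsg A) (y : seq A) :=
  FSG (fsg_ctx_subproof x u y).

Definition fsg_mul (A : choiceType) (u v : fsg A) : fsg A := fsg_ctx [::] u v.

Lemma fsg_mulA (A : choiceType) : associative (@fsg_mul A).
Proof. by move=> u v w; apply/val_inj; rewrite /= catA. Qed.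

HB.instance Definition _ (A : choiceType) :=
  isSemigroup.Build (fsg A) (@fsg_mulA A).

Record presentation := Presentation {
  gens : choiceType;
  rules : set (fsg gens * fsg gens) }.

Arguments rules : clear implicits.

Definition finite_presentation (P : presentation) :=
  finite_set [set: gens P] /\ finite_set (rules P).

Definition congruence (T : semigroupType) (E : T -> T -> Prop) :=
  [/\ forall u, E u u,
      forall u v, E u v -> E v u,
      forall u v w, E u v -> E v w -> E u w &
      forall u u' v v', E u u' -> E v v' -> E (u * v) (u' * v')].

(** The smallest congruence <->* on A^+ containing the rules. *)
Definition rewr (P : presentation) (u v : fsg (gens P)) : Prop :=
  forall E, congruence E -> (forall r, rules P r -> E r.1 r.2) -> E u v.

Lemma rewr_congruence (P : presentation) : congruence (@rewr P).
Proof.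
split=> [u|u v uv|u v w uv vw|u u' v v' uu' vv'] E cE rE; case: (cE) => r s t m.
- exact: r.
- by apply: s; apply: uv.
- by apply: (t _ v); [apply: uv|apply: vw].
- by apply: m; [apply: uu'|apply: vv'].
Qed.

Definition rewrb (P : presentation) : rel (fsg (gens P)) :=
  fun u v => `[< rewr u v >].

Lemma rewrb_equiv (P : presentation) : equiv_class_of (@rewrb P).
Proof.
have [r s t _] := rewr_congruence P; split=> [u|u v|v u w].
- exact/asboolP.
- by apply/asboolP/asboolP; apply: s.
- by move=> /asboolP uv /asboolP vw; apply/asboolP; apply: t uv vw.
Qed.

Canonical rewr_equiv (P : presentation) := EquivRelPack (rewrb_equiv P).

(** A^+/<->*. *)
Definition presented (P : presentation) := {eq_quot (rewr_equiv P)}.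

HB.instance Definition _ (P : presentation) := Choice.on (presented P).
HB.instance Definition _ (P : presentation) :=
  EqQuotient.on (presented P).

Definition presented_mul (P : presentation) (x y : presented P) : presented P :=
  \pi_(presented P) (repr x * repr y).

Lemma presented_mul_pi (P : presentation) (u v : fsg (gens P)) :
  presented_mul (\pi u) (\pi v) = \pi_(presented P) (u * v).
Proof.
have [_ _ _ m] := rewr_congruence P.
apply/eqmodP/asboolP; apply: m; apply/asboolP.
  by have /eqmodP := reprK (\pi_(presented P) u).
by have /eqmodP := reprK (\pi_(presented P) v).
Qed.

Lemma presented_mulA (P : presentation) : associative (@presented_mul P).
Proof.
move=> x y z; rewrite -[x]reprK -[y]reprK -[z]reprK.
by rewrite !presented_mul_pi mulgA.
Qed.

HB.instance Definition _ (P : presentation) :=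
  isSemigroup.Build (presented P) (@presented_mulA P).

Definition defines (P : presentation) (T : semigroupType) :=
  exists f : {multiplicative presented P -> T}, bijective f.

Section DerivationGraph.
Variable P : presentation.
Local Notation A := (gens P).

(** The sign [true] stands for +1. *)
Record edge := Edge {
  elctx : seq A; erule : set_type (rules P); esign : bool; erctx : seq A }.

Definition rule_side (r : set_type (rules P)) (eps : bool) : fsg A :=
  if eps then (val r).1 else (val r).2.

Definition esrc (e : edge) : fsg A :=
  fsg_ctx (elctx e) (rule_side (erule e) (esign e)) (erctx e).
Definition etgt (e : edge) : fsg A :=
  fsg_ctx (elctx e) (rule_side (erule e) (~~ esign e)) (erctx e).
Definition einv (e : edge) : edge :=
  Edge (elctx e) (erule e) (~~ esign e) (erctx e).
Definition eact (x : seq A) (e : edge) (y : seq A) : edge :=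
  Edge (x ++ elctx e) (erule e) (esign e) (erctx e ++ y).

(** A path is given by its initial vertex and its edges; P(Gamma) consists of
    the pairs satisfying [is_path]. *)
Record gpath := GPath { psrc : fsg A; pedges : seq edge }.

Fixpoint composable (u : fsg A) (es : seq edge) : Prop :=
  if es is e :: es' then esrc e = u /\ composable (etgt e) es' else True.

Definition is_path (p : gpath) := composable (psrc p) (pedges p).
Definition ptgt (p : gpath) : fsg A := last (psrc p) (map etgt (pedges p)).

Definition pempty (u : fsg A) : gpath := GPath u [::].
(** Meaningful only when [ptgt p = psrc q]. *)
Definition pcat (p q : gpath) : gpath := GPath (psrc p) (pedges p ++ pedges q).
Definition pinv (p : gpath) : gpath :=
  GPath (ptgt p) (rev (map einv (pedges p))).
Definition pact (x : seq A) (p : gpath) (y : seq A) : gpath :=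
  GPath (fsg_ctx x (psrc p) y) [seq eact x e y | e <- pedges p].
Definition pedge (e : edge) : gpath := GPath (esrc e) [:: e].

Definition parallel (p q : gpath) :=
  [/\ is_path p, is_path q, psrc p = psrc q & ptgt p = ptgt q].

Record homotopy_relation (sim : gpath -> gpath -> Prop) : Prop := {
  homotopy_parallel : forall p q, sim p q -> parallel p q;
  homotopy_refl : forall p, is_path p -> sim p p;
  homotopy_sym : forall p q, sim p q -> sim q p;
  homotopy_trans : forall p q r, sim p q -> sim q r -> sim p r;
  homotopy_H1 : forall e1 e2 : edge,
    sim (pcat (pedge (eact [::] e1 (esrc e2))) (pedge (eact (etgt e1) e2 [::])))
        (pcat (pedge (eact (esrc e1) e2 [::])) (pedge (eact [::] e1 (etgt e2))));
  homotopy_H2 : forall x y p q, sim p q -> sim (pact x p y) (pact x q y);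
  homotopy_H3 : forall p q r s, is_path r -> is_path s ->
    ptgt r = psrc p -> ptgt p = psrc s ->
    sim p q -> sim (pcat (pcat r p) s) (pcat (pcat r q) s);
  homotopy_H4 : forall p, is_path p -> sim (pcat p (pinv p)) (pempty (psrc p)) }.

(** The smallest homotopy relation containing [C], when [C] is contained in
    [parallel]. *)
Definition homotopy_gen (C : set (gpath * gpath)) (p q : gpath) : Prop :=
  forall sim, homotopy_relation sim ->
    (forall c, C c -> sim c.1 c.2) -> sim p q.

Definition homotopy_base (C : set (gpath * gpath)) :=
  (forall c, C c -> parallel c.1 c.2) /\
  (forall p q, homotopy_gen C p q <-> parallel p q).

End DerivationGraph.

Definition presentation_FDT (P : presentation) :=
  exists C : set (gpath P * gpath P), finite_set C /\ homotopy_base C.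

Definition FDT (T : semigroupType) :=
  exists P : presentation,
    [/\ finite_presentation P, defines P T & presentation_FDT P].

(* Main.v *)
Require Import Defs.
From HB Require Import structures.
From mathcomp Require Import all_boot generic_quotient.
From mathcomp Require Import boolp classical_sets cardinality.

(** The argument is a Reidemeister-Schreier rewriting carried out one dimension
    higher, on homotopies between derivations instead of on derivations.

    Let [P] present the monoid, with alphabet [A], and let [I] be the finite
    set of right cosets.  Right multiplication makes [I] a partial automaton
    over [A]; a partial map is enough, because once a translate has stopped
    being a coset no further multiplication can bring it back.  Choosing
    [rho i] in every coset [i], with [rho] equal to the identity [e] of the
    subgroup [G] on the coset [G], each transition [i --a--> j] determines a
    unique [g] in [G] with [rho i * a = g * rho j].  The pairs [(i, a)] are
    the letters of a presentation of [G] (lemma [schreier_defines]).  Two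
    translations relate it to [P]:
    - tracing a word [w] from a coset [i] gives the word of transitions
      [trace i w].  Tracing acts on derivations too, since a rule of [P] met
      in state [j] becomes a rule of the new presentation;
    - expanding a letter gives some word [loop (i, a)] of [P] for its value in
      [G].
    The rules are the traces of the rules of [P], and the rules
    [(i, a) = trace G (loop (i, a))], which let every word [b] be unravelled
    letter by letter into [trace G (expand b)].

    Tracing is compatible with all the closure properties of homotopy
    relations, so a homotopy relation on the new derivation graph pulls back
    to one on the graph of [P] ([pullback_homotopy]).  Consequently, if a
    homotopy relation contains the traces of a homotopy base of [P], any two
    parallel derivations of [P] have homotopic traces.  Expansion need not be
    functorial on derivations: it suffices that a derivation from [b] to [b']
    commutes, along the unravellings of [b] and [b'], with the trace of some
    derivation from [expand b] to [expand b'].  Squares of this kind compose,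
    and they are stable under adding contexts ([homotopic_whisker]), so
    finitely many of them, one for each rule and direction, imply all the
    others ([naturality]).  Given two parallel derivations in the new graph,
    both are therefore homotopic, up to the same unravellings, to traces of
    parallel derivations of [P], hence to each other.  The traced base
    together with the squares is a finite homotopy base ([schreier_FDT]). *)

Set Implicit Arguments.
Unset Strict Implicit.
Unset Printing Implicit Defensive.

Local Open Scope classical_set_scope.
Local Open Scope group_scope.
Local Open Scope quotient_scope.

(** * Walks in the derivation graph *)

Lemma fsg_neq0 (A : choiceType) (u : fsg A) : fsgval u != [::].
Proof. by case: u. Qed.

Definition letter (A : choiceType) (a : A) : fsg A :=
  FSG (isT : [:: a] != [::]).

Lemma finite_set_typeT T (A : set T) :
  finite_set A -> finite_set [set: set_type A].
Proof. by rewrite (eq_finite_set (card_setT A)). Qed.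

Section Walks.
Variable P : presentation.
Local Notation A := (gens P).
Implicit Types (s t w x y : seq A) (u v : fsg A) (e : edge P).
Implicit Types (es : seq (edge P)) (p q : gpath P).

(** Vertices of the derivation graph are nonempty words, whereas contexts may
    be empty.  Taking all end points in [seq A] allows a context and a word to
    be treated alike: the only walk from the empty word is the empty one. *)
Definition source e : seq A := esrc e.
Definition target e : seq A := etgt e.
Arguments source : simpl never.
Arguments target : simpl never.

Fixpoint walk s es t : Prop :=
  if es is e :: es' then source e = s /\ walk (target e) es' t else s = t.

Definition act_edges x es y := [seq eact x e y | e <- es].
Definition inv_edges es := rev [seq einv e | e <- es].

Lemma einvK : involutive (@einv P).
Proof. by case=> x r eps y; rewrite /einv /= negbK. Qed.

Lemma target_inv e : target (einv e) = source e.
Proof. by rewrite -{2}[e]einvK. Qed.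

Lemma source_act x e y : source (eact x e y) = x ++ source e ++ y.
Proof. by rewrite /source /= -!catA. Qed.

Lemma target_act x e y : target (eact x e y) = x ++ target e ++ y.
Proof. by rewrite /target /= -!catA. Qed.

Lemma target_neq0 e : target e != [::].
Proof. exact: fsg_neq0. Qed.

Lemma eact_act x x' e y y' :
  eact x (eact x' e y') y = eact (x ++ x') e (y' ++ y).
Proof. by rewrite /eact /= !catA. Qed.

Lemma eact_nil e : eact [::] e [::] = e.
Proof. by case: e => *; rewrite /eact /= cats0. Qed.

Lemma act_edges_nil es : act_edges [::] es [::] = es.
Proof. by rewrite /act_edges (eq_map eact_nil) map_id. Qed.

Lemma act_edges_act x x' es y y' :
  act_edges x (act_edges x' es y') y = act_edges (x ++ x') es (y' ++ y).
Proof.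
by rewrite /act_edges -map_comp; apply: eq_map => e; apply: eact_act.
Qed.

Lemma act_edges_split x es y :
  act_edges x es y = act_edges x (act_edges [::] es y) [::].
Proof. by rewrite act_edges_act !cats0. Qed.

Lemma act_edges_cat x es es' y :
  act_edges x (es ++ es') y = act_edges x es y ++ act_edges x es' y.
Proof. exact: map_cat. Qed.

Lemma walk1 e : walk (source e) [:: e] (target e).
Proof. by []. Qed.

Lemma walk_cat s t w es es' :
  walk s es t -> walk t es' w -> walk s (es ++ es') w.
Proof.
by elim: es s => [|e es IH] s /= => [->//|[-> h] h']; split=> //; apply: IH.
Qed.

Lemma walk_act x s es t y :
  walk s es t -> walk (x ++ s ++ y) (act_edges x es y) (x ++ t ++ y).
Proof.
elim: es s => [|e es IH] s /= => [->//|[<- h]].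
split; first exact: source_act.
by have := IH _ h; rewrite -target_act.
Qed.

Lemma walk_actr s es t y :
  walk s es t -> walk (s ++ y) (act_edges [::] es y) (t ++ y).
Proof. exact: (@walk_act [::]). Qed.

Lemma walk_actl x s es t :
  walk s es t -> walk (x ++ s) (act_edges x es [::]) (x ++ t).
Proof. by move/(walk_act x [::]); rewrite !cats0. Qed.

Lemma walk_inv s es t : walk s es t -> walk t (inv_edges es) s.
Proof.
elim: es s => [|e es IH] s /= => [->//|[<- /IH h]].
rewrite /inv_edges /= rev_cons -cats1; apply: walk_cat h _.
by split; rewrite ?target_inv.
Qed.

Lemma walk_neq0 s es t : walk s es t -> s != [::] -> t != [::].
Proof.
elim: es s => [|e es IH] s /= => [->//|[_ /IH h _]].
exact/h/target_neq0.
Qed.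

Lemma walkP u v es :
  walk u es v <-> composable u es /\ last u (map (@etgt P) es) = v.
Proof.
elim: es u => [|e es IH] u /=.
  by split=> [/val_inj ->|[_ ->]].
split=> [[/val_inj <-] /(IH (etgt e)) []|[[<- h] hv]] //.
by split=> //; apply/(IH (etgt e)).
Qed.

Lemma path_walk p : is_path p -> walk (psrc p) (pedges p) (ptgt p).
Proof. by move=> h; apply/walkP. Qed.

Lemma walk_path u v es :
  walk u es v -> is_path (GPath u es) /\ ptgt (GPath u es) = v.
Proof. by move/walkP. Qed.

Lemma walk_parallel u v es es' :
  walk u es v -> walk u es' v -> parallel (GPath u es) (GPath u es').
Proof.
by move=> /walk_path[h1 h2] /walk_path[h3 h4]; split; rewrite ?h2 ?h4 //.
Qed.

Lemma parallel_walk p q : parallel p q ->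
  [/\ psrc q = psrc p, walk (psrc p) (pedges p) (ptgt p) &
      walk (psrc p) (pedges q) (ptgt p)].
Proof.
case=> /path_walk hp /path_walk hq es et; split=> //.
by rewrite es et.
Qed.

(** Parallelism being itself a homotopy relation, the relation generated by a
    set of parallel pairs never leaves it. *)
Lemma parallel_homotopy : homotopy_relation (@parallel P).
Proof.
split=> //.
- by move=> p q [].
- by move=> p q r [? _ e1 e2] [_ ? e3 e4]; split=> //; congruence.
- move=> e1 e2; rewrite /pcat /pedge /=.
  have -> : esrc (eact [::] e1 (esrc e2)) = esrc (eact (esrc e1) e2 [::]).
    by apply: val_inj; rewrite /= !cats0 -!catA.
  apply: (@walk_parallel _ (etgt (eact (etgt e1) e2 [::]))).
  + by do 2?split; rewrite /source /target /= ?cats0 -?catA.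
  + by do 2?split; rewrite /source /target /= ?cats0 -?catA.
- move=> x y [u es] [u' es'] /parallel_walk[/= -> h h'].
  by apply: (@walk_parallel _ (fsg_ctx x _ y)); apply: walk_act; eassumption.
- move=> [u es] [u' es'] [a r] [b s] /path_walk /= hr /path_walk /= hs.
  move=> hru hsb /parallel_walk[/= -> h h'].
  rewrite hru in hr; rewrite -hsb in hs; rewrite /pcat /= -!catA.
  have hes := walk_cat hr (walk_cat h hs).
  exact: walk_parallel hes (walk_cat hr (walk_cat h' hs)).
- move=> [u es] /path_walk /= h; apply: (@walk_parallel _ u) => //=.
  exact: walk_cat h (walk_inv h).
Qed.

Lemma homotopy_base_intro (C : set (gpath P * gpath P)) :
  (forall c, C c -> parallel c.1 c.2) ->
  (forall sim, homotopy_relation sim -> (forall c, C c -> sim c.1 c.2) ->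
     forall p q, parallel p q -> sim p q) ->
  homotopy_base C.
Proof.
move=> hC h; split=> // p q; split=> [|pq sim hsim simC]; last exact: h.
by apply; first exact: parallel_homotopy.
Qed.

(** A congruence on the free semigroup only provides nonempty contexts; each
    empty side has to be handled apart. *)
Lemma rewr_ctx x u v y : rewr u v -> rewr (fsg_ctx x u y) (fsg_ctx x v y).
Proof.
have [r _ _ m] := rewr_congruence P; move=> uv.
have ctxl : rewr (fsg_ctx x u [::]) (fsg_ctx x v [::]).
  case: x => [|a x].
    have ctx0 (z : fsg A) : fsg_ctx [::] z [::] = z.
      by apply: val_inj; rewrite /= cats0.
    by rewrite !ctx0.
  have ctxE (z : fsg A) :
      fsg_ctx (a :: x) z [::] = FSG (isT : a :: x != [::]) * z.
    by apply: val_inj; rewrite /= cats0.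
  by rewrite !ctxE; apply: m (r _) uv.
case: y => [//|b y].
have ctxE (z : fsg A) : fsg_ctx x z (b :: y) =
    fsg_ctx x z [::] * FSG (isT : b :: y != [::]).
  by apply: val_inj; rewrite /= cats0 catA.
by rewrite !ctxE; apply: m ctxl (r _).
Qed.

(** Being joined by a walk is a congruence containing the rules, which gives
    one direction; the other is by induction on the walk. *)
Lemma rewr_walkP u v : rewr u v <-> exists es, walk u es v.
Proof.
have [r s t _] := rewr_congruence P; split.
  move/(_ (fun u v => exists es, walk u es v)); apply=> [|r' hr]; last first.
    exists [:: Edge [::] (exist _ r' (mem_set hr)) true [::]].
    by rewrite /= /source /target /= !cats0.
  split=> [w|w w'|w w' w''|w w' z z'].
  - by exists [::].
  - by case=> es /walk_inv; exists (inv_edges es).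
  - by case=> es h [es' h']; exists (es ++ es'); apply: walk_cat h h'.
  - case=> es h [es' h']; exists (act_edges [::] es z ++ act_edges w' es' [::]).
    exact: walk_cat (walk_actr _ h) (walk_actl _ h').
case=> es; elim: es u => [|e es IH] u /=; first by move/val_inj->.
case=> /val_inj <- /IH; apply: t => {es IH}.
case: e => x [r' hr] eps y; have rr' : rewr r'.1 r'.2.
  by move=> E _; apply; exact: set_mem hr.
by apply: rewr_ctx; case: eps => //=; apply: s.
Qed.
End Walks.

(** * Homotopies between lists of edges *)

Section Homotopy.
Variable P : presentation.
Local Notation A := (gens P).
Variable sim : gpath P -> gpath P -> Prop.
Hypothesis hsim : homotopy_relation sim.
Implicit Types (s t w x y : seq A) (u v : fsg A) (e : edge P).
Implicit Types (es : seq (edge P)) (p q : gpath P).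

(** The quantification makes the relation hold vacuously at the empty word,
    where no vertex exists.  Concatenation and interchange then hold for all
    words; only a context, which could turn the empty word into a vertex,
    requires a nonempty one. *)
Definition homotopic s es es' :=
  forall u, fsgval u = s -> sim (GPath u es) (GPath u es').

Lemma homotopic_refl s es t : walk s es t -> homotopic s es es.
Proof.
move=> h u us; apply: (homotopy_refl hsim); rewrite -us in h.
have tn := walk_neq0 h (fsg_neq0 u).
by have [] := walk_path (h : walk u es (FSG tn)).
Qed.

Lemma homotopic_sym s es es' : homotopic s es es' -> homotopic s es' es.
Proof. by move=> h u us; apply: (homotopy_sym hsim); apply: h. Qed.

Lemma homotopic_trans s es es' es'' :
  homotopic s es es' -> homotopic s es' es'' -> homotopic s es es''.
Proof.
by move=> h h' u us; apply: (homotopy_trans hsim) (h u us) (h' u us).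
Qed.

Lemma homotopic_act x s y es es' : s != [::] -> homotopic s es es' ->
  homotopic (x ++ s ++ y) (act_edges x es y) (act_edges x es' y).
Proof.
move=> sn h u us.
have -> : u = fsg_ctx x (FSG sn) y by apply: val_inj.
exact: (homotopy_H2 hsim x y (h (FSG sn) erefl)).
Qed.

Lemma homotopic_catl s t w r es es' : walk s r t -> walk t es w ->
  homotopic t es es' -> homotopic s (r ++ es) (r ++ es').
Proof.
move=> hr hes h u us; rewrite -us in hr.
have tn := walk_neq0 hr (fsg_neq0 u); have wn := walk_neq0 hes tn.
have [pr er] := walk_path (hr : walk u r (FSG tn)).
have [_ ees] := walk_path (hes : walk (FSG tn) es (FSG wn)).
have := homotopy_H3 hsim (p := GPath (FSG tn) es) 
  (s := pempty (FSG wn)) pr I er ees  (h (FSG tn) erefl).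
by rewrite /pcat /= !cats0.
Qed.

Lemma homotopic_catr s t w es es' r : walk s es t -> walk t r w ->
  homotopic s es es' -> homotopic s (es ++ r) (es' ++ r).
Proof.
move=> hes hr h u us; rewrite -us in hes.
have tn := walk_neq0 hes (fsg_neq0 u); have wn := walk_neq0 hr tn.
have [pr er] := walk_path (hr : walk (FSG tn) r (FSG wn)).
have [_ ees] := walk_path (hes : walk u es (FSG tn)).
have := homotopy_H3 hsim (p := GPath u es) (r := pempty u)
  (s := GPath (FSG tn) r) I pr erefl ees
  (h u us).
by rewrite /pcat.
Qed.

Lemma homotopic_inv s es t : walk s es t ->
  homotopic s (es ++ inv_edges es) [::].
Proof.
move=> h u us; rewrite -us in h; have tn := walk_neq0 h (fsg_neq0 u).
have [pes ees] := walk_path (h : walk u es (FSG tn)).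
exact: (homotopy_H4 hsim pes).
Qed.

(** Each of the two walks is recovered, up to homotopy, by following [r] after
    it and then undoing [r]. *)
Lemma homotopic_cancelr s t w es es' r :
  walk s es t -> walk s es' t -> walk t r w ->
  homotopic s (es ++ r) (es' ++ r) -> homotopic s es es'.
Proof.
move=> hes hes' hr h.
have absorb qs : walk s qs t -> homotopic s ((qs ++ r) ++ inv_edges r) qs.
  move=> hqs; rewrite -catA -[X in homotopic _ _ X]cats0.
  by apply: homotopic_catl hqs (walk_cat hr (walk_inv hr)) (homotopic_inv hr).
apply: homotopic_trans (homotopic_sym (absorb _ hes)) _.
apply: homotopic_trans (absorb _ hes').
exact: homotopic_catr (walk_cat hes hr) (walk_inv hr) h.
Qed.

Lemma homotopic_exchange1 e e' :
  homotopic (source e ++ source e')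
    [:: eact [::] e (source e'); eact (target e) e' [::]]
    [:: eact (source e) e' [::]; eact [::] e (target e')].
Proof.
move=> u us; have := homotopy_H1 hsim e e'; rewrite /pcat /pedge /=.
have -> : esrc (eact [::] e (esrc e')) = u.
  by apply: val_inj; rewrite [RHS]us /source /= -!catA.
have -> // : esrc (eact (esrc e) e' [::]) = u.
by apply: val_inj; rewrite [RHS]us /source /= cats0 -!catA.
Qed.

(** Disjoint derivations commute: the interchange of two edges, propagated along
    the second walk for a fixed edge of the first, then along the first. *)
Lemma homotopic_exchange s s' t t' es es' : walk s es s' -> walk t es' t' ->
  homotopic (s ++ t)
    (act_edges [::] es t ++ act_edges s' es' [::])
    (act_edges s es' [::] ++ act_edges [::] es t').
Proof.
have exch1 e : walk t es' t' -> homotopic (source e ++ t)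
    (eact [::] e t :: act_edges (target e) es' [::])
    (act_edges (source e) es' [::] ++ [:: eact [::] e t']).
  elim: es' t => [|e' es' IH] t0 /= => [-> //|[<- h]].
    apply: homotopic_refl (_ : walk _ _ (target e ++ t')).
    by split; rewrite ?source_act ?target_act.
  have w1 : walk (source e ++ source e')
    [:: eact (source e) e' [::]; eact [::] e (target e')]
    (target e ++ target e').
    by do 2?split; rewrite ?source_act ?target_act ?cats0.
  have w0 : walk (source e ++ source e')
    [:: eact [::] e (source e'); eact (target e) e' [::]]
    (target e ++ target e').
    by do 2?split; rewrite ?source_act ?target_act ?cats0.
  have ex := homotopic_exchange1 (e := e) (e' := e').
  apply: homotopic_trans (homotopic_catr w0 (walk_actl (target e) h) ex) _.
  have w2 : walk (source e ++ source e') [:: eact (source e) e' [::]]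
    (source e ++ target e').
    by split; rewrite ?source_act ?target_act ?cats0.
  apply: homotopic_catl w2 (_ : walk _ _ (target e ++ t')) (IH _ h).
  split; rewrite ?source_act ?target_act //.
  exact: walk_actl.
move=> hs ht; elim: es s hs => [|e es IH] s /=.
  move=> <-; rewrite cats0.
  exact: homotopic_refl (walk_actl _ ht).
case=> <- h.
have we : walk (source e ++ t) [:: eact [::] e t] (target e ++ t).
  by split; rewrite ?source_act ?target_act.
apply: homotopic_trans (homotopic_catl we _ (IH _ h)) _.
  exact: walk_cat (walk_actr _ h) (walk_actl _ ht).
rewrite /= -[X in homotopic _ _ X]cat_rcons -cats1.
have w1 : walk (source e ++ t)
  (eact [::] e t :: act_edges (target e) es' [::]) (target e ++ t').
  by split; rewrite ?source_act ?target_act //; apply: walk_actl.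
exact: homotopic_catr w1 (walk_actr t' h) (exch1 e ht).
Qed.

(** A commutative square with sides [es], [ub], [ua], [es'] stays commutative
    after adding the contexts [x] and [y], where the contexts themselves are
    moved along [ux] and [uy].  By interchange, [es] slides past [ux] and
    [es'] past [uy], and what remains is the square in a fixed context. *)
Lemma homotopic_whisker x x' y y' a a' b b' ux uy ua ub es es' : a != [::] ->
  walk x ux x' -> walk y uy y' -> walk a ua a' -> walk b ub b' ->
  walk a es b -> walk a' es' b' ->
  homotopic a (es ++ ub) (ua ++ es') ->
  homotopic (x ++ a ++ y)
    (act_edges x es y ++ act_edges [::] ux (b ++ y) ++
       act_edges x' (act_edges [::] ub y ++ act_edges b' uy [::]) [::])
    ((act_edges [::] ux (a ++ y) ++
       act_edges x' (act_edges [::] ua y ++ act_edges a' uy [::]) [::]) ++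
     act_edges x' es' y').
Proof.
move=> an wx wy wa wb we we' sq.
have wey := walk_actr y we; have wby := walk_actr y wb.
have wuy := walk_actl b' wy.
(* [es] slides past [ux]. *)
have H1 := homotopic_exchange wx wey; rewrite -!act_edges_split in H1.
have w1 : walk (x ++ a ++ y) (act_edges x es y ++ act_edges [::] ux (b ++ y))
  (x' ++ b ++ y).
  exact: walk_cat (walk_act x y we) (walk_actr (b ++ y) wx).
have w2 := walk_actl x' (walk_cat wby wuy).
rewrite [X in homotopic _ X _]catA.
apply: homotopic_trans (homotopic_catr w1 w2 (homotopic_sym H1)) _.
have wua : walk (x ++ a ++ y) (act_edges [::] ux (a ++ y)) (x' ++ a ++ y).
  exact: walk_actr wx.
have wR := walk_cat wey (walk_cat wby wuy).
rewrite -!catA (act_edges_split x' es y) (act_edges_split x' es' y').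
rewrite -!act_edges_cat; apply: homotopic_catl wua (walk_actl x' wR) _.
have ayn : a ++ y != [::] by case: (a) an.
rewrite -[x' ++ a ++ y]cats0 -catA; apply: homotopic_act => //.
(* The given square, then the slide of [es'] past [uy]. *)
have := homotopic_catr _ wuy (@homotopic_act [::] a y _ _ an sq).
rewrite !act_edges_cat -!catA /= => H; apply: homotopic_trans (H _) _.
  exact: walk_cat wey wby.
apply: homotopic_catl (walk_actr y wa) (walk_cat (walk_actr y we') wuy) _.
exact: homotopic_exchange.
Qed.

End Homotopy.

(** * The Schreier presentation of a partial automaton *)

Section Schreier.
Variables (P : presentation) (I : choiceType).
Local Notation A := (gens P).
Local Notation B := (I * A)%type.
Variables (step : I -> A -> I) (live : I -> seq A -> Prop).
Variables (i0 : I) (loop : B -> fsg A).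
Local Notation steps := (foldl step).

Fixpoint trace i (w : seq A) : seq B :=
  if w is a :: w' then (i, a) :: trace (step i a) w' else [::].

Lemma trace_cat i u v : trace i (u ++ v) = trace i u ++ trace (steps i u) v.
Proof. by elim: u i => [//|a u IH] i /=; rewrite IH. Qed.

Lemma steps_cat i u v : steps i (u ++ v) = steps (steps i u) v.
Proof. exact: foldl_cat. Qed.

Lemma trace_neq0 i (w : fsg A) : trace i w != [::].
Proof. by case: (fsgval w) (fsg_neq0 w). Qed.

Definition trace_word i (w : fsg A) : fsg B := FSG (trace_neq0 i w).

Definition expand (b : seq B) : seq A := flatten [seq fsgval (loop c) | c <- b].

Lemma expand_cat a b : expand (a ++ b) = expand a ++ expand b.
Proof. by rewrite /expand map_cat flatten_cat. Qed.

Lemma expand_neq0 (b : fsg B) : expand b != [::].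
Proof.
case: (fsgval b) (fsg_neq0 b) => [//|c s] _; rewrite /expand /=.
by case: (fsgval (loop c)) (fsg_neq0 (loop c)).
Qed.

Definition expand_word (b : fsg B) : fsg A := FSG (expand_neq0 b).

(** [live] tells which words the partial automaton [step] can read; [step] is
    total, with arbitrary values on the other words.  The conditions on
    [live] and [step] say that the presented semigroup acts partially on the
    states.  The conditions on [loop] say that every letter expands to a loop
    at the base state, that equal words have traces with equal expansions, and
    that a loop is equal to the expansion of its own trace. *)
Record schreier_system : Prop := {
  schreier_live_nil : forall i, live i [::];
  schreier_live_cat : forall i u v,
    live i (u ++ v) <-> live i u /\ live (steps i u) v;
  schreier_live_rewr : forall i (u v : fsg A),
    rewr u v -> live i u -> live i v /\ steps i u = steps i v;
  schreier_loop_live : forall b,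
    live i0 (loop b) /\ steps i0 (loop b) = i0;
  schreier_loop_trace : forall i (u v : fsg A), rewr u v -> live i u ->
    rewr (expand_word (trace_word i u)) (expand_word (trace_word i v));
  schreier_loop_retract : forall b,
    rewr (loop b) (expand_word (trace_word i0 (loop b))) }.

Definition trace_rule i (r : fsg A * fsg A) :=
  (trace_word i r.1, trace_word i r.2).
Definition loop_rule b := (letter b, trace_word i0 (loop b)).

(** Letters [(i, a)] for which [i] cannot read [a] are kept: the second family
    of rules gives them the value of their loop, so they only rename an
    element. *)
Definition schreier_rules : set (fsg B * fsg B) :=
  [set trace_rule ir.1 ir.2 | ir in [set ir | rules P ir.2 /\ live ir.1 ir.2.1]]
  `|` range loop_rule.

Definition schreier := Presentation schreier_rules.
Local Notation Q := schreier.

Lemma finite_schreier : finite_set [set: I] ->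
  finite_presentation P -> finite_presentation schreier.
Proof.
move=> finI [fA fR]; split.
  by rewrite -setXTT; apply: finite_setX.
rewrite /= /schreier_rules finite_setU; split; apply: finite_image; last first.
  by rewrite -setXTT; apply: finite_setX.
by apply: sub_finite_set (finite_setX finI fR) => -[i r] /= [].
Qed.

Hypothesis sys : schreier_system.
Let live_nil := schreier_live_nil sys.
Let live_cat := schreier_live_cat sys.
Let live_rewr := schreier_live_rewr sys.
Let loop_live := schreier_loop_live sys.

Lemma expand_live (b : seq B) : live i0 (expand b) /\ steps i0 (expand b) = i0.
Proof.
elim: b => [|c b [IHl IHs]]; first by split.
have [cl cs] := loop_live c.
rewrite -cat1s expand_cat /expand /= cats0 -/(expand b) steps_cat cs.
by split=> //; apply/live_cat; rewrite cs.
Qed.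

(** The traced rule is looked up in the set of rules, so that the trace of an
    edge is defined without carrying a proof of liveness.  It can only be
    missing when the source of the edge is not live. *)
Definition find_rule i r : option (set_type (rules Q)) :=
  insub (trace_rule i r).

Definition trace_edge i (e : edge P) : option (edge Q) :=
  omap (fun r => @Edge Q (trace i (elctx e)) r (esign e)
    (trace (steps i (elctx e ++ rule_side (erule e) (esign e))) (erctx e)))
  (find_rule (steps i (elctx e)) (val (erule e))).

Lemma rule_rewr (r : set_type (rules P)) eps :
  rewr (rule_side r eps) (rule_side r (~~ eps)).
Proof.
have [_ s _ _] := rewr_congruence P.
have h : rewr (val r).1 (val r).2 by move=> E _; apply; apply: set_mem (valP r).
by case: eps => //=; apply: s.
Qed.

(** The part to the right of the rewritten factor has the same trace before and
    after, since both sides of a rule lead to the same state. *)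
Lemma trace_edgeP i e : live i (source e) -> exists e',
  [/\ trace_edge i e = Some e', source e' = trace i (source e) &
      target e' = trace i (target e)].
Proof.
case: e => x r eps y; rewrite /source /target /=.
move=> /live_cat[_ /live_cat[lr _]].
have rr := rule_rewr r eps; have [lr' sr] := live_rewr rr lr.
have hr : trace_rule (steps i x) (val r) \in rules Q.
  apply: mem_set; left; exists (steps i x, val r) => //=.
  by split; [apply: set_mem (valP r)|case: (eps) lr lr'].
rewrite /trace_edge /find_rule /= insubT /=; eexists; split=> //.
  by rewrite /source /= !trace_cat steps_cat; case: (eps).
rewrite /target /= !trace_cat steps_cat sr; by case: (eps).
Qed.

Definition trace_edges i := pmap (trace_edge i).

Lemma trace_edge_act i x e y :
  trace_edge i (eact x e y) =
  omap (fun e' : edge Q =>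
      @eact Q (trace i x) e' (trace (steps i (x ++ source e)) y))
    (trace_edge (steps i x) e).
Proof.
rewrite /trace_edge /= (steps_cat i x (elctx e)).
case: find_rule => //= r; congr Some.
by rewrite /eact /= !trace_cat /source /= !steps_cat.
Qed.

Lemma walk_live i s es t : walk s es t -> live i s ->
  live i t /\ steps i s = steps i t.
Proof.
elim: es s => [|e es IH] s /= => [->//|[<- h] l].
have [l' ->] : live i (target e) /\ steps i (source e) = steps i (target e).
  by apply: live_rewr l; apply/rewr_walkP; exists [:: e].
exact: IH.
Qed.

Lemma trace_walk i s es t : walk s es t -> live i s ->
  @walk Q (trace i s) (trace_edges i es) (trace i t).
Proof.
elim: es s => [|e es IH] s /= => [->//|[<- h] l].
have [l' _] := walk_live (walk1 e) l.
have [e' [-> es' et']] := trace_edgeP l.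
by rewrite /= et'; split=> //; apply: IH.
Qed.

Lemma trace_edges_cat i es es' :
  trace_edges i (es ++ es') = trace_edges i es ++ trace_edges i es'.
Proof. exact: pmap_cat. Qed.

Lemma trace_edges_act i x s es t y : walk s es t -> live i (x ++ s) ->
  trace_edges i (act_edges x es y) =
  @act_edges Q (trace i x) (trace_edges (steps i x) es)
    (trace (steps i (x ++ s)) y).
Proof.
elim: es s => [|e es IH] s //= [<- h] /live_cat[lx l].
have [e' [E _ _]] := trace_edgeP l; have [l' ss] := walk_live (walk1 e) l.
rewrite trace_edge_act E /= steps_cat ss -steps_cat.
by rewrite -/(act_edges x es y) (IH _ h) //; apply/live_cat.
Qed.

Lemma trace_edge_inv i e : live i (source e) ->
  trace_edge i (einv e) = omap (@einv Q) (trace_edge i e).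
Proof.
case: e => x r eps y; rewrite /source /= => /live_cat[_ /live_cat[lr _]].
have [_ sr] := live_rewr (rule_rewr r eps) lr.
rewrite /trace_edge /=; case: find_rule => //= q.
by rewrite /einv /= !steps_cat sr.
Qed.

Lemma trace_edges_inv i s es t : walk s es t -> live i s ->
  trace_edges i (inv_edges es) = inv_edges (trace_edges i es).
Proof.
elim: es s => [|e es IH] s //= [<- h] l.
have [e' [E _ _]] := trace_edgeP l; have [l' _] := walk_live (walk1 e) l.
rewrite /inv_edges /= rev_cons -cats1 trace_edges_cat /= trace_edge_inv // E /=.
by rewrite rev_cons -cats1 -/(inv_edges _) (IH _ h).
Qed.

Section Pullback.
Variable sim : gpath Q -> gpath Q -> Prop.
Hypothesis hsim : homotopy_relation sim.
Local Notation homotopic := (homotopic sim).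

(** All states are considered at once: a left context changes the state from
    which an edge is traced. *)
Definition pullback (p q : gpath P) := parallel p q /\
  forall i, live i (psrc p) ->
    homotopic (trace i (psrc p)) (trace_edges i (pedges p))
      (trace_edges i (pedges q)).

Lemma pullback_homotopy : homotopy_relation pullback.
Proof.
have par := @parallel_homotopy P.
split.
- by move=> p q [].
- move=> p hp; split=> [|i l]; first exact: homotopy_refl par _ hp.
  exact: (homotopic_refl hsim) (trace_walk (path_walk hp) l).
- move=> p q [pq h]; split=> [|i]; first exact: homotopy_sym par _ _ pq.
  have [-> _ _] := parallel_walk pq => l; apply: (homotopic_sym hsim); exact: h.
- move=> p q r [pq h] [qr h']; split=> [|i l].
    exact: homotopy_trans par _ _ _ pq qr.
  have [e _ _] := parallel_walk pq.
  by apply: (homotopic_trans hsim) (h i l) _; rewrite -e; apply: h'; rewrite e.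
- move=> e1 e2; split=> [|i]; first exact: homotopy_H1 par _ _.
  set w := fsgval (psrc _).
  have -> : w = source e1 ++ source e2 := source_act [::] e1 (source e2).
  rewrite /= => /live_cat[l1 l2].
  have [e1' [E1 s1 t1]] := trace_edgeP l1.
  have [e2' [E2 s2 t2]] := trace_edgeP l2.
  have [_ ss] := walk_live (walk1 e1) l1.
  rewrite !trace_edge_act /= -ss E1 E2 /= trace_cat -s1 -s2 -t1 -t2.
  exact: homotopic_exchange1.
- move=> x y p q [pq h]; split=> [|i]; first exact: homotopy_H2 par _ _ _ _ pq.
  have [e hp hq] := parallel_walk pq.
  rewrite /= => l; move/live_cat: (l) => [lx /live_cat[lp _]].
  have lxp : live i (x ++ psrc p) by apply/live_cat.
  rewrite -!/(act_edges _ _ _) (trace_edges_act _ hp) //.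
  rewrite (trace_edges_act _ hq) // !trace_cat steps_cat.
  apply: (homotopic_act hsim); first exact: trace_neq0.
  exact: h.
- move=> p q r s hr hs erp eps [pq h]; split=> [|i l].
    exact: (homotopy_H3 par hr hs erp eps pq).
  have [e hp hq] := parallel_walk pq.
  have wr := path_walk hr; have ws := path_walk hs.
  rewrite erp in wr; rewrite -eps in ws.
  have [lp _] := walk_live wr l; have [lq _] := walk_live hp lp.
  rewrite /= !trace_edges_cat -!catA.
  have twp := trace_walk hp lp; have tws := trace_walk ws lq.
  apply: (homotopic_catl hsim (trace_walk wr l) (walk_cat twp tws)).
  exact: (homotopic_catr hsim twp tws (h i lp)).
- move=> p hp; split=> [|i l]; first exact: homotopy_H4 par _ hp.
  have wp := path_walk hp.
  rewrite /= -/(inv_edges _) trace_edges_cat (trace_edges_inv wp l).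
  exact: (homotopic_inv hsim (trace_walk wp l)).
Qed.

End Pullback.

(** * The homotopy base of the Schreier presentation *)

Lemma expand_cons c b : expand (c :: b) = loop c ++ expand b.
Proof. by []. Qed.

Lemma trace_expand_cons c b :
  trace i0 (expand (c :: b)) = trace i0 (loop c) ++ trace i0 (expand b).
Proof. by rewrite expand_cons trace_cat (loop_live c).2. Qed.

(** The first letter is replaced by the trace of its loop, and the rest is then
    treated behind that trace; this leads to the trace of the expansion
    because expansions are loops at the base state. *)
Fixpoint unravel (b : seq B) : seq (edge Q) :=
  if b is c :: b' then
    @Edge Q [::]
      (exist _ (loop_rule c) (mem_set (or_intror (imageT loop_rule c))))
      true b' :: @act_edges Q (trace i0 (loop c)) (unravel b') [::]
  else [::].

Lemma unravel_walk b : @walk Q b (unravel b) (trace i0 (expand b)).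
Proof.
elim: b => [//|c b IH]; split=> //.
rewrite trace_expand_cons.
exact: (@walk_actl Q) IH.
Qed.

Lemma unravel_cat a b : unravel (a ++ b) =
  @act_edges Q [::] (unravel a) b ++
  @act_edges Q (trace i0 (expand a)) (unravel b) [::].
Proof.
elim: a => [|c a IH]; first by rewrite (@act_edges_nil Q).
rewrite trace_expand_cons cat_cons /= IH (@act_edges_cat Q) !(@act_edges_act Q).
by rewrite !cats0.
Qed.

Lemma schreier_rule_walk (r : set_type (rules Q)) (eps : bool) :
  exists es, walk (expand (rule_side r eps)) es (expand (rule_side r (~~ eps))).
Proof.
suff [es h] : exists es, walk (expand (val r).1) es (expand (val r).2).
  by case: eps => /=; [exists es|exists (inv_edges es); apply: walk_inv].
have [[[i r'] /= [hr l] <-]|[c _ <-]] /= := set_mem (valP r).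
  have rr : rewr r'.1 r'.2 by move=> E _; apply.
  by have /rewr_walkP := schreier_loop_trace sys rr l.
have /rewr_walkP[es] := schreier_loop_retract sys c.
by exists es; rewrite {1}/expand /= cats0.
Qed.

(** If the expansions are equal, a derivation between them can be traced, and
    the unravellings connect its ends to the given words. *)
Lemma schreier_rewr (u v : fsg (gens Q)) :
  rewr u v <-> rewr (expand_word u) (expand_word v).
Proof.
split=> [/(_ (fun a b => rewr (expand_word a) (expand_word b)))|]; last first.
  case/rewr_walkP => es /= h.
  apply/rewr_walkP; eexists.
  apply: walk_cat (unravel_walk u) (walk_cat _ (walk_inv (unravel_walk v))).
  exact: trace_walk h (expand_live u).1.
have [r s t m] := rewr_congruence P; apply.
  split=> [a|a b|a b c|a a' b b'].
  - exact: r.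
  - exact: s.
  - exact: t.
  - have E (x y : fsg B) : expand_word (x * y) = expand_word x * expand_word y.
      by apply: val_inj; exact: (expand_cat x y).
    by rewrite !E; apply: m.
move=> q hq; have [es h] := schreier_rule_walk (exist _ q (mem_set hq)) true.
by apply/rewr_walkP; exists es.
Qed.

Section Squares.
(** For each rule and direction, [L] is a derivation between the expansions of
    the two sides.  The choices for the two directions are independent, which
    avoids inverting squares. *)
Variable L : set_type (rules Q) * bool -> seq (edge P).
Hypothesis LP : forall z : set_type (rules Q) * bool,
  walk (expand (rule_side z.1 z.2)) (L z) (expand (rule_side z.1 (~~ z.2))).

Definition naturality_square (z : set_type (rules Q) * bool) :
    gpath Q * gpath Q :=
  (@GPath Q (rule_side z.1 z.2)
     (@Edge Q [::] z.1 z.2 [::] :: unravel (rule_side z.1 (~~ z.2))),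
   @GPath Q (rule_side z.1 z.2)
     (unravel (rule_side z.1 z.2) ++ trace_edges i0 (L z))).

Definition trace_path i (p : gpath P) : gpath Q :=
  @GPath Q (trace_word i (psrc p)) (trace_edges i (pedges p)).

Lemma naturality_walk (z : set_type (rules Q) * bool) :
  let s : seq B := rule_side z.1 z.2 in
  let t : seq B := rule_side z.1 (~~ z.2) in
  let t' := trace i0 (expand t) in
  @walk Q s (@Edge Q [::] z.1 z.2 [::] :: unravel t) t' /\
  @walk Q s (unravel s ++ trace_edges i0 (L z)) t'.
Proof.
move=> s t t'; split.
  split; first by rewrite /source /= cats0.
  by rewrite /target /= cats0; exact: unravel_walk.
apply: walk_cat (unravel_walk s) _.
exact: trace_walk (LP z) (expand_live s).1.
Qed.

Section Naturality.
Variable sim : gpath Q -> gpath Q -> Prop.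
Hypothesis hsim : homotopy_relation sim.
Hypothesis sim_square : forall z,
  sim (naturality_square z).1 (naturality_square z).2.
Local Notation homotopic := (homotopic sim).

(** An edge is a rule in a context, and its square is the whiskering of the
    square of the rule, the context being unravelled on either side. *)
Lemma naturality_edge (e : edge Q) : exists es : seq (edge P),
  walk (expand (source e)) es (expand (target e)) /\
  homotopic (source e) (e :: unravel (target e))
    (unravel (source e) ++ trace_edges i0 es).
Proof.
case: e => x r eps y.
have h := LP (r, eps); have [w1 w2] := naturality_walk (r, eps).
have sq : homotopic (rule_side r eps)
    (@Edge Q [::] r eps [::] :: unravel (rule_side r (~~ eps)))
    (unravel (rule_side r eps) ++ trace_edges i0 (L (r, eps))).
  by move=> a /val_inj ->; apply: (sim_square (r, eps)).
move: h w1 w2 sq; rewrite /source /target /=.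
move: (L _); set a : seq B := rule_side r eps.
set b : seq B := rule_side r (~~ eps).
move=> es h w1 w2 sq.
exists (act_edges (expand x) es (expand y)); split.
  by rewrite !expand_cat; apply: walk_act.
have ta : @walk Q (trace i0 (expand a)) (trace_edges i0 es)
    (trace i0 (expand b)).
  exact: trace_walk h (expand_live a).1.
have -> : trace_edges i0 (act_edges (expand x) es (expand y)) =
    @act_edges Q (trace i0 (expand x)) (trace_edges i0 es)
      (trace i0 (expand y)).
  have lx : live i0 (expand x ++ expand a).
    by rewrite -expand_cat; exact: (expand_live _).1.
  by rewrite (trace_edges_act _ h lx) -expand_cat !(expand_live _).2.
have an : a != [::] := fsg_neq0 (rule_side r eps).
have we : @walk Q a [:: @Edge Q [::] r eps [::]] b.
  by split; rewrite /source /target /= cats0.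
have := homotopic_whisker hsim an (unravel_walk x) (unravel_walk y)
  (unravel_walk a) (unravel_walk b) we ta sq.
by rewrite /= /eact /= cats0 !unravel_cat.
Qed.

(** The squares of successive edges share an unravelling, along which they are
    pasted. *)
Lemma naturality s es t : @walk Q s es t -> exists es' : seq (edge P),
  walk (expand s) es' (expand t) /\
  homotopic s (es ++ unravel t) (unravel s ++ trace_edges i0 es').
Proof.
elim: es s => [s ->|e es IH s [<- h]].
  exists [::]; split=> //; rewrite cats0.
  exact: (homotopic_refl hsim (unravel_walk t)).
have [es1 [w1 h1]] := naturality_edge e; have [es2 [w2 h2]] := IH _ h.
exists (es1 ++ es2); split; first exact: walk_cat w1 w2.
have tes := trace_walk w2 (expand_live _).1.
apply: (homotopic_trans hsim
  (homotopic_catl hsim (walk1 e) (walk_cat h (unravel_walk t)) h2)).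
rewrite catA cat1s trace_edges_cat catA.
apply: (homotopic_catr hsim _ tes h1).
by split=> //; apply: unravel_walk.
Qed.

Hypothesis sim_trace : forall i es es' (u v : fsg A), live i u ->
  walk u es v -> walk u es' v ->
  homotopic (trace i u) (trace_edges i es) (trace_edges i es').

(** Naturality turns two parallel walks, followed by an unravelling, into the
    traces of parallel walks, preceded by an unravelling; the final unravelling
    can be cancelled. *)
Lemma schreier_parallel_sim p q : parallel p q -> sim p q.
Proof.
case: p q => [u es] [u' es'] /parallel_walk[/= -> w w'].
have [fs [wf hf]] := naturality w; have [fs' [wf' hf']] := naturality w'.
apply: (_ : homotopic u es es') erefl.
apply: (homotopic_cancelr hsim w w' (unravel_walk _)).
apply: (homotopic_trans hsim hf).
apply: (homotopic_trans hsim) (homotopic_sym hsim hf').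
have lu := (expand_live u).1.
apply: (homotopic_catl hsim (unravel_walk _) (trace_walk wf lu)).
exact: (@sim_trace _ _ _ (expand_word u) (expand_word (ptgt (GPath u es)))).
Qed.

End Naturality.

End Squares.

(** The base consists of the traces of the given base from every state, and of
    the naturality squares of the rules. *)
Lemma schreier_FDT : finite_set [set: I] -> finite_presentation P ->
  presentation_FDT P -> presentation_FDT schreier.
Proof.
move=> finI /(finite_schreier finI)[_ finR] [X [finX [Xpar Xbase]]].
have [L LP] := choice (fun z : set_type (rules Q) * bool =>
  schreier_rule_walk z.1 z.2).
exists ([set (trace_path ic.1 ic.2.1, trace_path ic.1 ic.2.2) | ic in
          [set ic : I * (gpath P * gpath P) |
             live ic.1 (psrc ic.2.1) /\ X ic.2]]
        `|` range (naturality_square L)).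
split.
  rewrite finite_setU; split; apply: finite_image.
    by apply: sub_finite_set (finite_setX finI finX) => -[i r] /= [].
  rewrite -setXTT; apply: finite_setX; first exact: finite_set_typeT.
  exact: finite_finset.
apply: homotopy_base_intro => [c0|sim hsim simC p q].
  case=> [[[i c] /= [l Xc] <-]|[z _ <-]].
  have [e w w'] := parallel_walk (Xpar _ Xc).
  rewrite /trace_path e /=.
  apply: (@walk_parallel Q _ (trace_word i (ptgt c.1))); exact: trace_walk.
  have [w w'] := naturality_walk LP z; set t := trace i0 _ in w w'.
  have tn : t != [::].
    exact: (trace_neq0 i0 (expand_word (rule_side z.1 (~~ z.2)))).
  exact: (@walk_parallel Q _ (FSG tn)).
apply: (schreier_parallel_sim LP hsim) => [z|i es es' u v l w w'].
  by apply: simC; right; exists z.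
have [_ h] : pullback sim (GPath u es) (GPath u es'); last exact: h i l.
have /Xbase := walk_parallel w w'.
apply=> [|c Xc]; first exact: pullback_homotopy.
have [e wc wc'] := parallel_walk (Xpar _ Xc).
split=> [|j lj a aE]; first exact: Xpar.
have := simC _ (or_introl (ex_intro2 _ _ (j, c) (conj lj Xc) erefl)).
rewrite /trace_path /= e.
by have -> : trace_word j (psrc c.1) = a by apply: val_inj; rewrite [RHS]aE.
Qed.

End Schreier.

(** * Presentations as surjective evaluations *)

Section Evaluation.
Variables (P : presentation) (T : semigroupType).

(** What it means for [P] to present [T], expressed on words and not on the
    quotient. *)
Definition evaluation (h : fsg (gens P) -> T) :=
  [/\ {morph h : u v / u * v}, forall t, exists u, h u = t &
      forall u v, rewr u v <-> h u = h v].

Lemma defines_evaluation : defines P T -> exists h, evaluation h.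
Proof.
case=> f [g fK gK]; exists (fun u => f (\pi_(presented P) u)).
split=> [u v|t|u v].
- by rewrite -(presented_mul_pi u v) -gmulfM.
- by exists (repr (g t)); rewrite reprK gK.
split=> [uv|/(can_inj fK)/eqmodP/asboolP //].
by congr (f _); apply/eqmodP/asboolP.
Qed.

Lemma evaluation_defines h : evaluation h -> defines P T.
Proof.
move=> [hM hS hE].
pose f (x : presented P) := h (repr x).
have f_pi u : f (\pi u) = h u.
  apply/hE/asboolP; have /eqmodP := reprK (\pi_(presented P) u); exact.
have fM : {morph f : x y / x * y}.
  by move=> x y; rewrite -[x * y]/(\pi_(presented P) (repr x * repr y)) f_pi hM.
pose m := isMultiplicative.Build (presented P) T f fM.
pose F : {multiplicative presented P -> T} := HB.pack f m.
exists F; have [g gP] := choice hS.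
exists (fun t => \pi_(presented P) (g t)) => [x|t] /=; last by rewrite f_pi.
by rewrite -[RHS]reprK; apply/eqmodP/asboolP/hE; rewrite gP.
Qed.

End Evaluation.

(** * The automaton of right cosets *)

Section Subgroup.
Variables (S : monoidType) (G : subgroup S).

Lemma rtranslateM (C : set S) s t :
  rtranslate C (s * t) = rtranslate (rtranslate C s) t.
Proof.
apply/seteqP; split=> [_ [g Cg <-]|_ [_ [g Cg <-] <-]].
  by exists (g * s); rewrite ?mulgA //; exists g.
by exists g; rewrite ?mulgA.
Qed.

Lemma rtranslate1 (C : set S) : rtranslate C 1 = C.
Proof.
apply/seteqP; split=> [_ [g Cg <-]|g Cg]; first by rewrite mulg1.
by exists g; rewrite ?mulg1.
Qed.

(** If [C s t] can be brought back to [G], so can [C s]: translates that are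
    not cosets never become cosets again. *)
Lemma right_cosets_prefix (C : set S) s t : (exists c, C = rtranslate G c) ->
  right_cosets G (rtranslate C (s * t)) -> right_cosets G (rtranslate C s).
Proof.
move=> [c ->] [x [cstx [s' xs']]]; exists (c * s).
split; first by rewrite rtranslateM.
exists (t * s').
by rewrite (rtranslateM G c) (rtranslateM _ t) -(rtranslateM _ s t) cstx.
Qed.

Variable e : S.
Hypothesis Ge : subgroup_set G e.
Hypothesis G_group : forall x, subgroup_set G x ->
  [/\ e * x = x, x * e = x &
      exists2 y, subgroup_set G y & x * y = e /\ y * x = e].

Lemma rtranslate_subgroup g : subgroup_set G g -> rtranslate G g = G.
Proof.
move=> Gg; have [_ ge [g' Gg' [gg' g'g]]] := G_group Gg.
apply/seteqP; split=> [_ [x Gx <-]|x Gx]; first exact: subgroupM.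
have [_ xe _] := G_group Gx.
by exists (x * g'); [exact: subgroupM|rewrite -mulgA g'g xe].
Qed.

Lemma right_cosets_self : right_cosets G G.
Proof. by exists e; split; [|exists e]; rewrite !rtranslate_subgroup. Qed.

Local Notation I := (set_type (right_cosets G)).
Implicit Type i : I.

Lemma right_coset_rtranslate i r : val i r -> val i = rtranslate G r.
Proof.
have [s [-> _]] := set_mem (valP i).
by case=> g Gg <-; rewrite rtranslateM (rtranslate_subgroup Gg).
Qed.

(** By definition of a coset, some [s'] maps [r] into [G], where its image can
    be inverted. *)
Lemma right_coset_inv i r : val i r -> exists r', r * r' = e.
Proof.
move=> ir; have iE := right_coset_rtranslate ir.
have [s [isE [s' ss']]] := set_mem (valP i).
have : subgroup_set G (r * s') by rewrite -[subgroup_set G]ss' -isE; exists r.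
by case/G_group=> _ _ [y _ [rs'y _]]; exists (s' * y); rewrite mulgA.
Qed.

Lemma right_coset_cancel i r g g' :
  val i r -> subgroup_set G g -> subgroup_set G g' -> g * r = g' * r -> g = g'.
Proof.
move=> /right_coset_inv[r' rr'] /G_group[_ ge _] /G_group[_ ge' _] E.
by rewrite -ge -ge' -rr' !mulgA E.
Qed.

Definition coset_act i s : I := insubd i (rtranslate (val i) s).

Lemma val_act i s : right_cosets G (rtranslate (val i) s) ->
  val (coset_act i s) = rtranslate (val i) s.
Proof. by move=> h; rewrite insubdK //; apply: mem_set. Qed.

Variables (P : presentation) (h : fsg (gens P) -> S).
Hypothesis hP : evaluation h.
Local Notation A := (gens P).

Definition eval_letter (a : A) := h (letter a).

Fixpoint eval (w : seq A) : S :=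
  if w is a :: w' then eval_letter a * eval w' else 1.

Lemma eval_cat u v : eval (u ++ v) = eval u * eval v.
Proof. by elim: u => [|a u IH] /=; rewrite ?mul1g // IH mulgA. Qed.

Lemma eval_word (u : fsg A) : eval u = h u.
Proof.
have [hM _ _] := hP.
suff E w (wn : w != [::]) : eval w = h (FSG wn).
  by rewrite (E _ (fsg_neq0 u)); congr h; apply: val_inj.
elim: w wn => // a [|b w] IH wn.
  by rewrite /= mulg1; congr h; apply: val_inj.
have -> : FSG wn = letter a * FSG (isT : b :: w != [::]) by apply: val_inj.
by rewrite hM -IH.
Qed.

Definition coset_live i w := right_cosets G (rtranslate (val i) (eval w)).
Definition coset_step i a := coset_act i (eval_letter a).
Local Notation steps := (foldl coset_step).

Lemma coset_translate i : exists c, val i = rtranslate G c.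
Proof. by have [s [-> _]] := set_mem (valP i); exists s. Qed.

Lemma coset_live_cons i a w :
  coset_live i (a :: w) <->
  coset_live i [:: a] /\ coset_live (coset_step i a) w.
Proof.
rewrite /coset_live /= mulg1; split=> [l|[l]]; last first.
  by rewrite /coset_step val_act // -rtranslateM.
have l1 := right_cosets_prefix (coset_translate i) l.
by split=> //; rewrite /coset_step val_act // -rtranslateM.
Qed.

Lemma coset_live_nil i : coset_live i [::].
Proof. by rewrite /coset_live rtranslate1; apply: set_mem (valP i). Qed.

Lemma coset_live_cat i u v :
  coset_live i (u ++ v) <-> coset_live i u /\ coset_live (steps i u) v.
Proof.
elim: u i => [|a u IH] i /=.
  by split=> [|[]] //; split=> //; apply: coset_live_nil.
split=> [/coset_live_cons[la /IH[lu lv]]|[/coset_live_cons[la lu] lv]].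
  by split=> //; apply/coset_live_cons.
by apply/coset_live_cons; split=> //; apply/IH.
Qed.

Lemma val_coset_steps i w :
  coset_live i w -> val (steps i w) = rtranslate (val i) (eval w).
Proof.
elim: w i => [|a w IH] i; first by rewrite /= rtranslate1.
move/coset_live_cons=> [la lw] /=.
rewrite IH // /coset_step val_act -?rtranslateM //.
by move: la; rewrite /coset_live /= mulg1.
Qed.

Lemma coset_live_rewr i (u v : fsg A) :
  rewr u v -> coset_live i u -> coset_live i v /\ steps i u = steps i v.
Proof.
have [_ _ hE] := hP; move/hE=> uv lu.
have lv : coset_live i v by move: lu; rewrite /coset_live !eval_word uv.
by split=> //; apply: val_inj; rewrite !val_coset_steps // !eval_word uv.
Qed.

Definition coset0 : I := exist _ (G : set S) (mem_set right_cosets_self).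

Lemma live_subgroup w : subgroup_set G (eval w) ->
  coset_live coset0 w /\ steps coset0 w = coset0.
Proof.
move=> Gw; have lw : coset_live coset0 w.
  by rewrite /coset_live /= rtranslate_subgroup //; apply: right_cosets_self.
by split=> //; apply: val_inj; rewrite val_coset_steps //= rtranslate_subgroup.
Qed.

(** The representative of the coset [G] has to be [e] for the value of a loop at
    [G] to be its value in the monoid, and not a conjugate. *)
Lemma coset_repr : exists rho : I -> S,
  (forall i, val i (rho i)) /\ rho coset0 = e.
Proof.
have [i|rho rhoP] := @choice I S (fun i r => val i r /\ (i = coset0 -> r = e)).
  have [->|ni] := pselect (i = coset0); first by exists e.
  have [c iE] := coset_translate i; exists (e * c); split=> //.
  by rewrite iE; exists e.
by exists rho; split=> [i|]; [have [] := rhoP i|apply: (rhoP coset0).2].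
Qed.

Variable rho : I -> S.
Hypothesis rhoP : forall i, val i (rho i).
Hypothesis rho0 : rho coset0 = e.

(** The value of the letter [(i, a)] exists because [rho i * a] lies in the
    coset reached from [i].  When [i] cannot read [a], any element of [G]
    will do. *)
Lemma schreier_generator (b : I * A) : exists w : fsg A, subgroup_set G (h w) /\
  (coset_live b.1 [:: b.2] ->
   rho b.1 * eval_letter b.2 = h w * rho (coset_step b.1 b.2)).
Proof.
have [_ hS _] := hP; case: b => i a /=.
have [la|nl] := pselect (coset_live i [:: a]); last first.
  by have [w hw] := hS e; exists w; rewrite hw.
have := la; rewrite /coset_live /= mulg1 => ca.
have : val (coset_step i a) (rho i * eval_letter a).
  by rewrite /coset_step val_act //; exists (rho i).
rewrite (right_coset_rtranslate (rhoP (coset_step i a))) => -[g Gg E].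
by have [w hw] := hS g; exists w; rewrite hw E.
Qed.

Variable loop : I * A -> fsg A.
Hypothesis loopP : forall b, subgroup_set G (h (loop b)) /\
  (coset_live b.1 [:: b.2] ->
   rho b.1 * eval_letter b.2 = h (loop b) * rho (coset_step b.1 b.2)).

Lemma eval_expand (b : fsg (I * A)%type) :
  subgroup_set G (eval (expand loop b)).
Proof.
have E c (s : seq (I * A)) : subgroup_set G (eval (expand loop (c :: s))).
  elim: s c => [|d s IH] c.
    by rewrite /expand /= cats0 eval_word; exact: (loopP c).1.
  rewrite [expand _ _]/(loop c ++ expand loop (d :: s)) eval_cat eval_word.
  by apply: subgroupM; [exact: (loopP c).1|exact: IH].
by case: (fsgval b) (fsg_neq0 b) => // c s _; apply: E.
Qed.

(** The defining relation of the letters, telescoped along a word. *)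
Lemma eval_trace i w : coset_live i w ->
  rho i * eval w = eval (expand loop (trace coset_step i w)) * rho (steps i w).
Proof.
elim: w i => [|a w IH] i; first by rewrite /= mulg1 mul1g.
move/coset_live_cons=> [la lw].
rewrite /= mulgA (loopP (i, a)).2 //= -mulgA IH //.
by rewrite /expand /= eval_cat eval_word mulgA.
Qed.

Lemma eval_trace0 w : subgroup_set G (eval w) ->
  eval (expand loop (trace coset_step coset0 w)) * e = e * eval w.
Proof.
move=> /live_subgroup[lw sw].
by rewrite -{2}rho0 eval_trace // sw rho0.
Qed.

Local Notation exp_word := (@expand_word P I loop).

Lemma coset_loop_live b :
  coset_live coset0 (loop b) /\ steps coset0 (loop b) = coset0.
Proof. by apply: live_subgroup; rewrite eval_word; exact: (loopP b).1. Qed.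

(** The values in [G] of the two traces agree after multiplication by the same
    representative, which can be cancelled. *)
Lemma coset_loop_trace i (u v : fsg A) : rewr u v -> coset_live i u ->
  rewr (exp_word (trace_word coset_step i u))
    (exp_word (trace_word coset_step i v)).
Proof.
move=> uv lu; have [lv suv] := coset_live_rewr uv lu; have [_ _ hE] := hP.
apply/hE; rewrite -!eval_word.
apply: (right_coset_cancel (rhoP (steps i u))); try exact: eval_expand.
rewrite /= -eval_trace // suv -eval_trace // !eval_word.
by congr (_ * _); apply/hE.
Qed.

(** A word with value in [G] is a loop at the coset [G], whose representative is
    [e]: the value of its trace is its own value. *)
Lemma trace_retract w : subgroup_set G (h w) ->
  rewr w (exp_word (trace_word coset_step coset0 w)).
Proof.
move=> Gw; have [_ _ hE] := hP; apply/hE; rewrite -!eval_word.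
have Gw' : subgroup_set G (eval w) by rewrite eval_word.
have [_ te _] := G_group (eval_expand (trace_word coset_step coset0 w)).
have [ew _ _] := G_group Gw'.
by rewrite -ew -eval_trace0 // te.
Qed.

Lemma coset_system :
  schreier_system coset_step coset_live coset0 loop.
Proof.
split; [exact: coset_live_nil|exact: coset_live_cat|exact: coset_live_rewr
  |exact: coset_loop_live|exact: coset_loop_trace|move=> b].
by apply: trace_retract; exact: (loopP b).1.
Qed.

Lemma schreier_defines :
  defines (schreier coset_step coset_live coset0 loop) (subgroup_type G).
Proof.
pose H (b : fsg (I * A)%type) : subgroup_type G :=
  Sub (eval (expand loop b)) (mem_set (eval_expand b)).
apply: (@evaluation_defines (schreier coset_step coset_live coset0 loop) _ H).
have [_ hS hE] := hP; split.
- by move=> a b; apply: val_inj; rewrite /= expand_cat eval_cat.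
- move=> [g Gg]; have [w hw] := hS g.
  have Gw : subgroup_set G (h w) by rewrite hw; apply: set_mem Gg.
  exists (trace_word coset_step coset0 w); apply: val_inj => /=.
  have /hE := trace_retract Gw; rewrite -!eval_word /= => <-.
  by rewrite eval_word.
move=> u v.
have E := schreier_rewr coset_system u v.
rewrite E hE -!eval_word; split=> [uv|/(congr1 val) //].
exact: val_inj.
Qed.

End Subgroup.

Theorem theorem1 (S : monoidType) (G : subgroup S) :
  FDT S -> finite_translational_index G -> FDT (subgroup_type G).
Proof.
case=> P [finP /defines_evaluation[h hP] fdtP] finG.
have [e Ge Ggroup] := subgroup_group G.
have [rho [rhoP rho0]] := coset_repr Ge Ggroup.
have [loop loopP] := choice (schreier_generator Ge Ggroup hP rhoP).
have sys := coset_system hP rhoP rho0 loopP.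
have finI := finite_set_typeT finG.
exists (schreier (coset_step h) (coset_live h) (coset0 Ge Ggroup) loop).
split; first exact: finite_schreier.
  exact: (schreier_defines hP rhoP rho0 loopP).
exact: (schreier_FDT sys finI finP fdtP).
Qed.
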